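(* Let $f$ be a fractal interpolation function with uniform vertical scaling factor $d\in(-1,1)$ on the Sierpinski gasket $SG$. Suppose that for every $p\in V_*\setminus V_0$ the pointwise Laplacian $\Delta f(p)=\lim_{m\to\infty}\frac32 5^m\Delta_mf(p)$ exists and is finite. Then $f$ satisfies one of the following conditions: (1) $f$ satisfies the ''$\frac15-\frac25$ rule'' at the points in $V_1\setminus V_0$, i.e. $f(q_{ij})=\frac25f(q_i)+\frac25f(q_j)+\frac15f(q_k)$ for every permutation $(i,j,k)$ of $(1,2,3)$; (2) $d=\frac15$ and $f(q_{12})+\frac15f(q_3)=f(q_{13})+\frac15f(q_2)=f(q_{23})+\frac15f(q_1)$. Furthermore, in case (1), $f$ is a harmonic function, so that $\Delta f=0$; and in case (2), $\Delta f$ is the constant $$\Delta f=3\bigl(2f(q_1)+2f(q_2)+f(q_3)-5f(q_{12})\bigr).$$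
   Context: Sierpinski gasket. Let $q_1,q_2,q_3\in\mathbb{R}^2$ be the vertices of an equilateral triangle, $P_i(x)=\frac12(x+q_i)$ for $i=1,2,3$, and $SG$ the unique nonempty compact set with $SG=\bigcup_{i=1}^3P_i(SG)$. For a word $\omega=\omega_1\cdots\omega_m$ with letters in $\{1,2,3\}$ put $P_\omega=P_{\omega_1}\circ\cdots\circ P_{\omega_m}$ (identity for the empty word) and $q_\omega=P_{\omega_1\cdots\omega_{m-1}}(q_{\omega_m})$; in particular $q_{ij}=P_i(q_j)$, $q_{ii}=q_i$, $q_{ij}=q_{ji}$. Let $V_0=\{q_1,q_2,q_3\}$, $V_m=\bigcup_{|\omega|=m}P_\omega(V_0)$, $V_*=\bigcup_{m\ge1}V_m$. For $m\ge 0$ and distinct $x,y\in V_m$, write $x\sim_my$ if there is a word $\omega$ of length $m$ with $x,y\in P_\omega(V_0)$. Harmonic functions. Let $\mathcal{E}_m(u)=\left(\frac53\right)^m\sum_{x\sim_my}(u(x)-u(y))^2$ (sum over unordered edges). A function $h$ on $SG$ is harmonic if $\mathcal{E}_{m-1}(h)=\mathcal{E}_m(h)$ for all $m\ge1$. FIF with uniform vertical scaling factor. For any $B:V_1\to\mathbb{R}$ and $d\in(-1,1)$ there is a unique continuous $f:SG\to\mathbb{R}$ with $f|_{V_1}=B$ and $f(P_i(x))=d\,f(x)+h_i(x)$ for all $x\in SG$, $i=1,2,3$, where each $h_i$ is a harmonic function on $SG$. Such $f$ is called a fractal interpolation function (FIF) on $SG$ with uniform vertical scaling factor $d$. Laplacian.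 For continuous $u$ on $SG$ and $m\ge1$, $\Delta_mu(x)=\sum_{y\sim_mx}(u(y)-u(x))$ for $x\in V_m\setminus V_0$. For a continuous function $g$ on $SG$, one says $u\in\mathrm{dom}\,\Delta$ with $\Delta u=g$ if $\frac325^m\Delta_mu(x)$ converges to $g$ uniformly on $V_*\setminus V_0$ as $m\to\infty$ (the expression being defined at $x\in V_m\setminus V_0$; i.e. $\sup_{x\in V_m\setminus V_0}|\frac325^m\Delta_mu(x)-g(x)|\to0$). *)

(* Defs.v *)
From mathcomp Require Import all_boot all_order all_algebra.
From mathcomp Require Import all_classical all_reals all_analysis.

Set Implicit Arguments.
Unset Strict Implicit.
Unset Printing Implicit Defensive.

Import Order.TTheory GRing.Theory Num.Theory.
Import numFieldNormedType.Exports.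

Local Open Scope classical_set_scope.
Local Open Scope ring_scope.

Definition i1 : 'I_3 := @Ordinal 3 0 isT.
Definition i2 : 'I_3 := @Ordinal 3 1 isT.
Definition i3 : 'I_3 := @Ordinal 3 2 isT.

Section SierpinskiGasket.
Variable R : realType.
Local Notation point := 'rV[R]_2.

(* The library norm on 'rV is the sup norm, hence an explicit Euclidean one. *)
Definition edist (x y : point) : R := Num.sqrt (\sum_(k < 2) (x 0 k - y 0 k) ^+ 2).

Definition equilateral (q : 'I_3 -> point) : Prop :=
  exists2 s : R, 0 < s & forall i j : 'I_3, i != j -> edist (q i) (q j) = s.

Variable q : 'I_3 -> point.

Definition P (i : 'I_3) (x : point) : point := 2^-1 *: (x + q i).

Definition is_SG (SG : set point) : Prop :=
  [/\ SG !=set0, compact SG & SG = \bigcup_(i in [set: 'I_3]) (P i @` SG)].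

(* Pw [:: w1; ...; wm] = P w1 \o ... \o P wm *)
Definition Pw (w : seq 'I_3) (x : point) : point := foldr P x w.

Definition qq (i j : 'I_3) : point := P i (q j).

Definition V0 : set point := range q.

Definition V (m : nat) : set point :=
  \bigcup_(w in [set w : seq 'I_3 | size w = m]) (Pw w @` V0).

Definition Vstar : set point := \bigcup_(m in [set m : nat | (1 <= m)%N]) V m.

Definition adj (m : nat) (x y : point) : Prop :=
  x <> y /\ exists w : seq 'I_3,
    [/\ size w = m, (Pw w @` V0) x & (Pw w @` V0) y].

(* Functions on SG are represented by total functions point -> R, of which only
   the values on SG are ever used. *)

(* The factor 1/2 turns the sum over ordered adjacent pairs into the sum over
   unordered edges. *)
Definition energy (m : nat) (u : point -> R) : R :=
  (5 / 3) ^+ m *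
  (2^-1 * \sum_(e \in [set e : point * point | adj m e.1 e.2])
            (u e.1 - u e.2) ^+ 2).

Definition is_harmonic (h : point -> R) : Prop :=
  forall m : nat, (1 <= m)%N -> energy m.-1 h = energy m h.

Definition is_FIF (SG : set point) (d : R) (f : point -> R) : Prop :=
  [/\ -1 < d < 1,
      {within SG, continuous f} &
      exists h : 'I_3 -> point -> R,
        (forall i, is_harmonic (h i)) /\
        (forall i x, SG x -> f (P i x) = d * f x + h i x)].

Definition graph_laplacian (m : nat) (u : point -> R) (x : point) : R :=
  \sum_(y \in [set y | adj m y x]) (u y - u x).

(* For x outside V m this takes the junk value 0; a point of Vstar lies in V m
   for all large m, so limits are not affected. *)
Definition scaled_laplacian (m : nat) (u : point -> R) (x : point) : R :=
  3 / 2 * 5 ^+ m * graph_laplacian m u x.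

Definition pointwise_laplacian_exists (u : point -> R) (p : point) : Prop :=
  cvg (scaled_laplacian m u p @[m --> \oo]).

Definition has_laplacian (SG : set point) (u g : point -> R) : Prop :=
  [/\ {within SG, continuous u},
      {within SG, continuous g} &
      forall e : R, 0 < e ->
        \forall m \near \oo, forall x, (V m `\` V0) x ->
          `|scaled_laplacian m u x - g x| <= e].

Definition one_fifth_two_fifths_rule (f : point -> R) : Prop :=
  forall i j k : 'I_3, uniq [:: i; j; k] ->
    f (qq i j) = 2 / 5 * f (q i) + 2 / 5 * f (q j) + 1 / 5 * f (q k).

Definition quadratic_case (d : R) (f : point -> R) : Prop :=
  [/\ d = 1 / 5,
      f (qq i1 i2) + 1 / 5 * f (q i3) = f (qq i1 i3) + 1 / 5 * f (q i2) &
      f (qq i1 i3) + 1 / 5 * f (q i2) = f (qq i2 i3) + 1 / 5 * f (q i1)].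

End SierpinskiGasket.

(* Main.v *)
Require Import Defs.
From mathcomp Require Import all_boot all_order all_algebra.
From mathcomp Require Import all_classical all_reals all_analysis.
From mathcomp Require Import ring lra.

Set Implicit Arguments.
Unset Strict Implicit.
Unset Printing Implicit Defensive.

Import Order.TTheory GRing.Theory Num.Theory.
Import numFieldNormedType.Exports.

Local Open Scope classical_set_scope.
Local Open Scope ring_scope.

(** The functional equation turns the graph Laplacians of f at the points q_ij
    into a linear recursion in the level, and the pointwise Laplacian can only
    exist if the component of its solution growing like 3^m vanishes.

    Geometry.  Equidistant points of the plane are affinely independent
    ([affine_independent]), so barycentric coordinates are available, and two
    cells P_i(T), P_j(T) of the triangle T meet only in q_ij ([P_meet]).
    Consequently the edges of level m+1 are the disjoint union of the images
    of the edges of level m under the three maps P_i.  This turns the energies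
    and the graph Laplacians into quantities computed by recursion on the
    first letter of a word: E_{m+1}(u) = 5/3 sum_i E_m(u o P_i) ([energy_S])
    and L_{m+1} u (x) = sum_i L_m (u o P_i) (P_i^{-1} x)
    ([graph_laplacian_S]), where terms with P_i^{-1} x outside V_m vanish.

    Harmonic functions.  Write x_k for the defect of the rule at q_ij, where
    {i,j,k} = {1,2,3}.  The gap E_1(u) - E_0(u) is a positive definite
    quadratic form in the three defects ([energy_gap]), so energies never
    decrease, and by recursion u is harmonic exactly when it satisfies the
    rule on every cell.  For harmonic h this gives L_m h (q_j) = (3/5)^m
    L_0 h (q_j) at the corners ([harmonic_corner]) and L_m h = 0 on
    V_m \ V_0 ([harmonic_interior]).

    The functional equation.  From f o P_i = d f + h_i, the corner values
    A_m(j) = L_m f (q_j) satisfy A_{m+1}(j) = d A_m(j) + (3/5)^m b_j, and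
    X_{m+1} = L_{m+1} f (q_ij) equals d (A_m(i) + A_m(j)) + (3/5)^m c_ij.
    Eliminating the A_m gives ([laplacian_junction_rec2])
      X_{m+2} = d X_{m+1} + (3/5)^(m+1) (x_i + x_j + (10 d - 4) x_k).
    After multiplication by 5^m the last term grows like 3^m, hence existence
    of the pointwise Laplacian at q_ij forces x_i + x_j + (10 d - 4) x_k = 0.
    Adding the three equations yields (10 d - 2)(x_1 + x_2 + x_3) = 0.  If
    d = 1/5 the equations say that the three defects are equal, which is the
    second alternative.  Otherwise the sum is zero and (10 d - 5) x_k = 0, so
    all defects vanish unless d = 1/2; in that case 5^m X_m is a constant times
    (5/2)^m, so convergence forces X_1 = -5 x_k to vanish as well.

    Conversely, the rule is inherited by every f o P_i since h_i satisfies it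
    on all cells, which makes f harmonic ([rule_keeps_energy]); and when
    d = 1/5 with equal defects x, the recursion gives L_{m+1} f = (1/5)^m (-2x)
    on all of V_{m+1} \ V_0 ([quadratic_laplacian]), so the scaled Laplacian
    is the constant -15 x already at finite level. *)

(** * Three indices *)

Lemma perm_enum_uniq3 (i j k : 'I_3) :
  uniq [:: i; j; k] -> perm_eq [:: i; j; k] (enum 'I_3).
Proof.
move=> ijk; apply: uniq_perm; rewrite ?enum_uniq// => l.
have [//||_ ->//] := @uniq_min_size _ [:: i; j; k] (enum 'I_3) ijk.
  by move=> ? _; rewrite mem_enum.
by rewrite size_enum_ord.
Qed.

Lemma sum_uniq3 (V : nmodType) (F : 'I_3 -> V) (i j k : 'I_3) :
  uniq [:: i; j; k] -> \sum_l F l = F i + F j + F k.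
Proof.
move=> /perm_enum_uniq3 ijk.
by rewrite -big_enum -(perm_big _ ijk)/= !big_cons big_nil addr0 addrA.
Qed.

Lemma ex_other (i : 'I_3) : exists j, i != j.
Proof. by case: i => [[|i] ?]; [exists i2 | exists i1]. Qed.

Lemma ex_third (i j : 'I_3) : i != j -> exists k, uniq [:: i; j; k].
Proof.
case: i j => [[|[|[|//]]] ?] [[|[|[|//]]] ?] // _;
  by [exists i1 | exists i2 | exists i3].
Qed.

Lemma uniq3_neq (i j k : 'I_3) :
  uniq [:: i; j; k] -> [/\ i != j, i != k & j != k].
Proof. by rewrite /= !inE !negb_or => /andP[/andP[-> ->] /andP[->]]. Qed.

Lemma uniq3_rot (i j k : 'I_3) : uniq [:: i; j; k] -> uniq [:: j; k; i].
Proof. by rewrite (rot_uniq 1 [:: i; j; k]). Qed.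

Lemma uniq3_swap (i j k : 'I_3) : uniq [:: i; j; k] -> uniq [:: j; i; k].
Proof.
move=> /uniq3_neq[ij ik jk].
by rewrite /= !inE negb_or eq_sym ij jk ik.
Qed.

(** * Cells of the triangle *)

Section Geometry.
Variables (R : realType) (q : 'I_3 -> 'rV[R]_2).
Hypothesis hq : equilateral q.

(** If the weights e_k sum to 0 and sum_k e_k q_k = 0, then
    sum_k e_k |q_k - y|^2 does not depend on y.  Taking y = q_j, where all
    nonzero distances equal s, shows that - e_j s^2 is the same for all j, so
    the e_k are equal, and then they are 0. *)
Lemma affine_independent (c c' : 'I_3 -> R) :
  \sum_k c k = \sum_k c' k ->
  \sum_k c k *: q k = \sum_k c' k *: q k -> c =1 c'.
Proof.
case: hq => s s0 eqs.
have dist i j : i != j ->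
    (q i 0 ord0 - q j 0 ord0) ^+ 2 + (q i 0 ord_max - q j 0 ord_max) ^+ 2 = s ^+ 2.
  move=> /eqs <-; rewrite /edist sqr_sqrtr; last first.
    by apply: sumr_ge0 => k _; rewrite sqr_ge0.
  by rewrite big_ord_recl big_ord1 (_ : lift _ _ = ord_max)//; exact: val_inj.
move=> sum_eq comb_eq l.
have [m lm] := ex_other l.
have [p lmp] := ex_third lm.
have coord (t : 'I_2) : \sum_k c k * q k 0 t = \sum_k c' k * q k 0 t.
  have combE b : (\sum_k b k *: q k) 0 t = \sum_k b k * q k 0 t.
    by rewrite summxE; apply: eq_bigr => k _; rewrite mxE.
  by rewrite -!combE comb_eq.
move: sum_eq (coord ord0) (coord ord_max) => {coord comb_eq}.
have [_ lp mp] := uniq3_neq lmp.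
have := dist _ _ lm; have := dist _ _ lp; have := dist _ _ mp.
rewrite !(sum_uniq3 _ lmp).
move: (q l 0 ord0) (q m 0 ord0) (q p 0 ord0) => xl xm xp.
move: (q l 0 ord_max) (q m 0 ord_max) (q p 0 ord_max) => yl ym yp.
move=> dmp dlp dlm Es Ex Ey.
have s2 : s ^+ 2 != 0 by rewrite expf_neq0// gt_eqF.
set e := c l - c' l; set g := c m - c' m; set h := c p - c' p.
have {}Es : h = - e - g by rewrite /e /g /h; lra.
have {}Ex : e * xl + g * xm + h * xp = 0 by rewrite /e /g /h; lra.
have {}Ey : e * yl + g * ym + h * yp = 0 by rewrite /e /g /h; lra.
(* N is the common value of sum_k e_k |q_k - y|^2, computed at y = 0. *)
pose N := e * (xl ^+ 2 + yl ^+ 2) + g * (xm ^+ 2 + ym ^+ 2)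
          + h * (xp ^+ 2 + yp ^+ 2).
pose sx := e * xl + g * xm + h * xp; pose sy := e * yl + g * ym + h * yp.
have Nl : g * s ^+ 2 + h * s ^+ 2 = N - 2 * xl * sx - 2 * yl * sy.
  by rewrite -{1}dlm -dlp /N /sx /sy Es; ring.
have Nm : e * s ^+ 2 + h * s ^+ 2 = N - 2 * xm * sx - 2 * ym * sy.
  by rewrite -{1}dlm -dmp /N /sx /sy Es; ring.
have Np : e * s ^+ 2 + g * s ^+ 2 = N - 2 * xp * sx - 2 * yp * sy.
  by rewrite -{1}dlp -dmp /N /sx /sy Es; ring.
rewrite /sx /sy Ex Ey !mulr0 !subr0 in Nl Nm Np.
have : e * s ^+ 2 = 0 by rewrite Es in Nl Nm; lra.
by move/eqP; rewrite mulf_eq0 (negPf s2) orbF subr_eq0 => /eqP.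
Qed.

Definition hull : set 'rV[R]_2 := [set x | exists c : 'I_3 -> R,
  [/\ forall k, 0 <= c k, \sum_k c k = 1 & x = \sum_k c k *: q k]].

Lemma sum_indic (V : lmodType R) (F : 'I_3 -> V) (i : 'I_3) :
  \sum_k (k == i)%:R *: F k = F i.
Proof.
rewrite (bigD1 i)//= eqxx scale1r big1 ?addr0// => k /negPf ->.
by rewrite scale0r.
Qed.

Lemma sum_indic1 (i : 'I_3) : \sum_k (k == i)%:R = 1 :> R.
Proof.
by rewrite (bigD1 i)//= eqxx big1 ?addr0// => k /negPf ->.
Qed.

Lemma hull_vertex (i : 'I_3) : hull (q i).
Proof.
by exists (fun k => (k == i)%:R); rewrite sum_indic sum_indic1; split.
Qed.

Lemma P_comb (i : 'I_3) (c : 'I_3 -> R) :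
  P q i (\sum_k c k *: q k) = \sum_k (2^-1 * (c k + (k == i)%:R)) *: q k.
Proof.
rewrite /P -{1}(sum_indic q i) -big_split scaler_sumr.
by apply: eq_bigr => k _; rewrite /= -scalerDl scalerA.
Qed.

Lemma sum_P_coef (i : 'I_3) (c : 'I_3 -> R) :
  \sum_k 2^-1 * (c k + (k == i)%:R) = 2^-1 * (\sum_k c k + 1).
Proof. by rewrite -mulr_sumr big_split sum_indic1. Qed.

Lemma hull_P (i : 'I_3) (x : 'rV[R]_2) : hull x -> hull (P q i x).
Proof.
move=> [c [c0 c1 ->]]; rewrite P_comb.
exists (fun k => 2^-1 * (c k + (k == i)%:R)); split=> //.
  by move=> k; rewrite mulr_ge0// addr_ge0.
by rewrite sum_P_coef c1; lra.
Qed.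

(** A point of the i-th cell has i-th barycentric coordinate at least 1/2.  A
    common point of the cells i and j therefore has these two coordinates
    equal to 1/2, that is, it is q_ij. *)
Lemma P_meetr (i j : 'I_3) (x y : 'rV[R]_2) :
  hull x -> hull y -> i != j -> P q i x = P q j y -> y = q i.
Proof.
move=> [c [c0 c1 ->]] [c' [c'0 c'1 ->]] ij.
rewrite !P_comb => /affine_independent E.
have {}E k : c k + (k == i)%:R = c' k + (k == j)%:R.
  apply: (@mulfI _ 2^-1); first by rewrite invr_neq0.
  by apply: E; rewrite !sum_P_coef c1 c'1.
have [k ijk] := ex_third ij.
move: c1 c'1; rewrite (sum_uniq3 _ ijk) (sum_uniq3 c' ijk) => c1 c'1.
have Ei : c i + 1 = c' i by have := E i; rewrite eqxx (negPf ij) addr0.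
have c'j := c'0 j; have c'k := c'0 k; have ci := c0 i.
rewrite (sum_uniq3 _ ijk).
have [-> -> ->] : [/\ c' i = 1, c' j = 0 & c' k = 0] by split; lra.
by rewrite scale1r !scale0r !addr0.
Qed.

Lemma P_meet (i j : 'I_3) (x y : 'rV[R]_2) :
  hull x -> hull y -> i != j -> P q i x = P q j y -> x = q j /\ y = q i.
Proof.
move=> hx hy ij E; split; last exact: P_meetr hx hy ij E.
by apply: P_meetr hy hx _ (esym E); rewrite eq_sym.
Qed.

Lemma q_inj : injective q.
Proof.
move=> i j; rewrite -{1}(sum_indic q i) -{1}(sum_indic q j).
move=> /affine_independent; rewrite !sum_indic1 => /(_ erefl i).
by rewrite eqxx; case: eqP => // _ /eqP; rewrite oner_eq0.
Qed.

Lemma P_inj (i : 'I_3) : injective (P q i).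
Proof.
by move=> x y /scalerI/addIr; apply; rewrite invr_neq0.
Qed.

Lemma P_fix (i : 'I_3) : P q i (q i) = q i.
Proof. by rewrite /P -mulr2n -[q i *+ 2]scaler_nat scalerA mulVf// scale1r. Qed.

Lemma qqC (i j : 'I_3) : qq q i j = qq q j i.
Proof. by rewrite /qq /P addrC. Qed.

Lemma VS (m : nat) : V q m.+1 = \bigcup_(i in [set: 'I_3]) (P q i @` V q m).
Proof.
apply/seteqP; split=> x.
  move=> [[//|i w]] /= [sw] [y Vy <-].
  by exists i => //; exists (Pw q w y) => //; exists w => //; exists y.
move=> [i _ [_ [w /= sw [y Vy <-]] <-]].
by exists (i :: w) => /=; [rewrite sw|exists y].
Qed.

Lemma V_0 : V q 0 = V0 q.
Proof.
apply/seteqP; split=> x; first by move=> [[|//] _ [y Vy <-]].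
by move=> Vx; exists [::] => //; exists x.
Qed.

Lemma V_sub_hull (m : nat) (x : 'rV[R]_2) : V q m x -> hull x.
Proof.
elim: m x => [|m IH] x; first by rewrite V_0 => -[i _ <-]; exact: hull_vertex.
by rewrite VS => -[i _ [y /IH hy <-]]; exact: hull_P.
Qed.

Lemma finite_V (m : nat) : finite_set (V q m).
Proof.
elim: m => [|m IH]; first by rewrite V_0; apply: finite_image; exact: finite_finset.
by rewrite VS; apply: bigcup_finite => // i _; exact: finite_image.
Qed.

Lemma adj_0 (x y : 'rV[R]_2) : adj q 0 x y <-> [/\ x <> y, V0 q x & V0 q y].
Proof.
split=> [[xy [w [/size0nil-> [a Va ax] [b Vb bY]]]]|[xy Vx Vy]].
  by split; rewrite // -?ax -?bY.
by split=> //; exists [::]; split=> //; [exists x|exists y].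
Qed.

Lemma adj_S (m : nat) (x y : 'rV[R]_2) : adj q m.+1 x y <->
  exists i x' y', [/\ adj q m x' y', x = P q i x' & y = P q i y'].
Proof.
split.
  move=> [xy [w [sw [a Va ax] [b Vb bY]]]].
  case: w sw ax bY => [//|i w] /= [sw] ax bY.
  exists i, (Pw q w a), (Pw q w b); split; rewrite ?ax ?bY//.
  split; first by move=> E; apply: xy; rewrite -ax -bY E.
  by exists w.
move=> [i [x' [y' [[xy [w [sw [a Va ax] [b Vb bY]]]] -> ->]]]].
split; first by move=> /P_inj.
exists (i :: w); split=> /=; first by rewrite sw.
  by exists a; rewrite ?ax.
by exists b; rewrite ?bY.
Qed.

Lemma adj_V (m : nat) (x y : 'rV[R]_2) : adj q m x y -> V q m x /\ V q m y.
Proof. by move=> [_ [w [sw Vx Vy]]]; split; exists w. Qed.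

End Geometry.
Lemma fsum_finType (R : realType) (I : finType) (D : pred I) (F : I -> R) :
  (forall i, ~~ D i -> F i = 0) -> \sum_(i \in [set i | D i]) F i = \sum_i F i.
Proof.
move=> F0; rewrite [RHS](bigID D)/= [X in _ + X]big1 ?addr0//.
by rewrite [RHS]bigfs ?index_enum_uniq// => i _; rewrite mem_index_enum.
Qed.

(** * Recursion on the first letter *)

Lemma fsum_bigcup_image (R : realType) (T T' : choiceType) (A : 'I_3 -> set T)
    (g : 'I_3 -> T -> T') (F : T' -> R) :
  (forall i, finite_set (A i)) -> (forall i, injective (g i)) ->
  (forall i j x y, i != j -> A i x -> A j y -> g i x <> g j y) ->
  \sum_(z \in \bigcup_(i in [set: 'I_3]) (g i @` A i)) F z =
  \sum_i \sum_(x \in A i) F (g i x).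
Proof.
move=> finA injg disj; pose B i := g i @` A i.
have ijk : uniq [:: i1; i2; i3] by [].
have -> : \bigcup_(i in [set: 'I_3]) (g i @` A i) = B i1 `|` B i2 `|` B i3.
  apply/seteqP; split=> [z [i _ Bz]|z].
    have := mem_enum 'I_3 i; rewrite -(perm_mem (perm_enum_uniq3 ijk)) !inE.
    by move=> /or3P[]/eqP E; rewrite E in Bz; [left; left|left; right|right].
  by move=> [[]|] Bz; [exists i1|exists i2|exists i3].
have finB i : finite_set (B i) by exact: finite_image.
have disjB i j : i != j -> B i `&` B j `<=` set0.
  by move=> ij z [[x Ax <-] [y Ay /esym]]; exact: disj.
have BE i : \sum_(z \in B i) F z = \sum_(x \in A i) F (g i x).
  by rewrite fsbig_image// => x y _ _; exact: injg.
rewrite fsbigU0//; last 2 first.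
- by rewrite finite_setU; split.
- by move=> z [[Bz|Bz] Bz3]; [apply: (disjB i1 i3)|apply: (disjB i2 i3)].
by rewrite fsbigU0//; [rewrite !BE (sum_uniq3 _ ijk)|exact: disjB].
Qed.

Section GraphRecursion.
Variables (R : realType) (q : 'I_3 -> 'rV[R]_2).
Hypothesis hq : equilateral q.
Local Notation point := 'rV[R]_2.
Local Notation L := (graph_laplacian q).
Local Notation E := (energy q).

Lemma finite_edges (m : nat) : finite_set [set e : point * point | adj q m e.1 e.2].
Proof.
apply: (@sub_finite_set _ _ (V q m `*` V q m)).
  by move=> [x y] /adj_V.
by apply: finite_setX; exact: finite_V.
Qed.

Lemma finite_neighbours (m : nat) (x : point) : finite_set [set y | adj q m y x].
Proof. by apply: sub_finite_set (finite_V q m) => y /adj_V[]. Qed.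

Lemma energy_0 (u : point -> R) :
  E 0 u = 2^-1 * \sum_i \sum_j (u (q i) - u (q j)) ^+ 2.
Proof.
rewrite /energy expr0 mul1r; congr (_ * _).
pose g (p : 'I_3 * 'I_3) := (q p.1, q p.2).
rewrite (_ : mkset _ = g @` [set p | p.1 != p.2]); last first.
  apply/seteqP; split=> [[x y] /adj_0[xy /= [i _ iE] [j _ jE]]|_ [[i j] /= ij <-]].
    exists (i, j); rewrite /g/= ?iE ?jE//; apply/eqP => ij.
    by apply: xy; rewrite -iE -jE ij.
  apply/adj_0; split; [|by exists i|by exists j].
  by move=> /(q_inj hq)/= ijE; rewrite ijE eqxx in ij.
rewrite fsbig_image; last first.
  by move=> [i j] [k l] _ _ [/(q_inj hq)/= + /(q_inj hq)/= +] => -> ->.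
rewrite pair_big/= (@fsum_finType _ _ (fun p => p.1 != p.2))//.
by move=> [i j] /= /negbNE/eqP ->; rewrite subrr expr0n.
Qed.

Lemma graph_laplacian_0 (u : point -> R) (j : 'I_3) :
  L 0 u (q j) = \sum_k (u (q k) - u (q j)).
Proof.
rewrite /graph_laplacian.
rewrite (_ : mkset _ = q @` [set k | k != j]); last first.
  apply/seteqP; split=> [y /adj_0[yj [k _ kE] _]|_ [k /= kj <-]].
    by exists k => //=; apply/eqP => kj; apply: yj; rewrite -kE kj.
  apply/adj_0; split; [|by exists k|by exists j].
  by move=> /(q_inj hq) kjE; rewrite kjE eqxx in kj.
rewrite fsbig_image; last by move=> k l _ _ /(q_inj hq).
by apply: (@fsum_finType _ _ (fun k => k != j)) => k /negbNE/eqP ->; rewrite subrr.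
Qed.

(** An edge of level m+1 lies in a single first-level cell: if it lay in two,
    [P_meet] would identify its endpoints. *)
Lemma energy_S (m : nat) (u : point -> R) :
  E m.+1 u = 5 / 3 * \sum_i E m (u \o P q i).
Proof.
rewrite /energy -mulr_sumr -mulr_sumr exprS -mulrA; congr (_ * (_ * (_ * _))).
pose g i (e : point * point) := (P q i e.1, P q i e.2).
rewrite (_ : mkset _ =
    \bigcup_(i in [set: 'I_3]) (g i @` [set e | adj q m e.1 e.2])); last first.
  apply/seteqP; split=> [[x y] /adj_S/=|_ [i _ [[x y] xy <-]]].
    by move=> [i [x' [y' [xy -> ->]]]]; exists i => //; exists (x', y').
  by apply/adj_S; exists i, x, y.
rewrite fsum_bigcup_image//.
- by move=> _; exact: finite_edges.
- by move=> i [x y] [x' y'] [/P_inj/= + /P_inj/= +] => -> ->.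
move=> i j [x y] [x' y'] ij /= xy xy' [Ex Ey].
have [/(V_sub_hull) hx /(V_sub_hull) hy] := adj_V xy.
have [/(V_sub_hull) hx' /(V_sub_hull) hy'] := adj_V xy'.
case: xy => + _; apply.
by rewrite (P_meet hq hx hx' ij Ex).1 (P_meet hq hy hy' ij Ey).1.
Qed.

Lemma P_inv (i : 'I_3) (x : point) : P q i (2 *: x - q i) = x.
Proof. by rewrite /P subrK scalerA mulVf// scale1r. Qed.

(** Stated at every point of the plane: [2 *: x - q i] is the preimage of x
    under [P q i], and a graph Laplacian vanishes at points that are not
    vertices.  Thus one formula covers corners, junction points and points inside
    a cell. *)
Lemma graph_laplacian_S (m : nat) (u : point -> R) (x : point) :
  L m.+1 u x = \sum_i L m (u \o P q i) (2 *: x - q i).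
Proof.
rewrite /graph_laplacian.
rewrite (_ : mkset _ = \bigcup_(i in [set: 'I_3])
    (P q i @` [set y | adj q m y (2 *: x - q i)])); last first.
  apply/seteqP; split=> [y /adj_S[i [y' [x' [yx -> xE]]]]|_ [i _ [y yx <-]]].
    exists i => //; exists y' => //=.
    by rewrite xE (P_inj (P_inv i (P q i x'))).
  by apply/adj_S; exists i, y, (2 *: x - q i); rewrite P_inv.
rewrite fsum_bigcup_image//.
- by apply: eq_bigr => i _; apply: eq_fsbigr => y _; rewrite /= P_inv.
- by move=> i; exact: finite_neighbours.
- by move=> i; exact: P_inj.
move=> i j y y' ij /= yx yx' Ey.
have [/(V_sub_hull) hy /(V_sub_hull) hx] := adj_V yx.
have [/(V_sub_hull) hy' /(V_sub_hull) hx'] := adj_V yx'.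
case: yx => + _; apply; rewrite (P_meet hq hy hy' ij Ey).1.
by rewrite (P_meet hq hx hx' ij _).1// !P_inv.
Qed.

Lemma energy_eq (m : nat) (u v : point -> R) :
  (forall x, V q m x -> u x = v x) -> E m u = E m v.
Proof.
move=> uv; rewrite /energy; congr (_ * (_ * _)); apply: eq_fsbigr => -[x y].
by rewrite inE => /adj_V[Vx Vy]; rewrite !uv.
Qed.

Lemma graph_laplacian_eq (m : nat) (u v : point -> R) (x : point) :
  (forall y, V q m y -> u y = v y) -> L m u x = L m v x.
Proof.
move=> uv; apply: eq_fsbigr => y.
by rewrite inE => /adj_V[Vx Vy]; rewrite !uv.
Qed.

Lemma graph_laplacian_lin (m : nat) (a : R) (u v : point -> R) (x : point) :
  L m (fun y => a * u y + v y) x = a * L m u x + L m v x.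
Proof.
have fin := finite_neighbours m x.
rewrite /graph_laplacian !fsbig_finite// mulr_sumr -big_split/=.
by apply: eq_bigr => y _; ring.
Qed.

Lemma graph_laplacian_notV (m : nat) (u : point -> R) (x : point) :
  ~ V q m x -> L m u x = 0.
Proof.
move=> nVx; rewrite /graph_laplacian fsbig1// => y /adj_V[_ Vx].
by case: nVx.
Qed.

(** A corner, and likewise the image under P_j of a vertex other than the
    corners, lies in one first-level cell, whereas q_ij lies in two; this is
    the number of terms that survive in the recursion. *)
Lemma graph_laplacian_corner (m : nat) (u : point -> R) (j : 'I_3) :
  L m.+1 u (q j) = L m (u \o P q j) (q j).
Proof.
rewrite graph_laplacian_S (bigD1 j)//= big1 ?addr0.
  by congr (L _ _ _); apply: (@P_inj _ q j); rewrite P_inv P_fix.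
move=> i ij; apply: graph_laplacian_notV => /(V_sub_hull) hx.
have := P_meet hq hx (hull_vertex q j) ij; rewrite P_inv P_fix.
by move=> /(_ erefl)[_ /(q_inj hq)] ijE; rewrite ijE eqxx in ij.
Qed.

Lemma graph_laplacian_inner (m : nat) (u : point -> R) (j : 'I_3) (y : point) :
  (V q m `\` V0 q) y -> L m.+1 u (P q j y) = L m (u \o P q j) y.
Proof.
move=> [Vy nV0y]; rewrite graph_laplacian_S (bigD1 j)//= big1 ?addr0.
  by congr (L _ _ _); apply: (@P_inj _ q j); rewrite P_inv.
move=> i ij; apply: graph_laplacian_notV => /(V_sub_hull) hx.
have := P_meet hq hx (V_sub_hull Vy) ij; rewrite P_inv => /(_ erefl)[_ yi].
by apply: nV0y; exists i.
Qed.

Lemma graph_laplacian_junction (m : nat) (u : point -> R) (i j : 'I_3) :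
  i != j -> L m.+1 u (qq q i j) = L m (u \o P q i) (q j) + L m (u \o P q j) (q i).
Proof.
move=> ij; have [k ijk] := ex_third ij.
have [_ ik jk] := uniq3_neq ijk.
rewrite graph_laplacian_S (sum_uniq3 _ ijk).
rewrite [X in _ + X]graph_laplacian_notV ?addr0.
  congr (L _ _ _ + L _ _ _).
    by apply: (@P_inj _ q i); rewrite P_inv.
  by apply: (@P_inj _ q j); rewrite P_inv qqC.
move=> /(V_sub_hull) hx.
have := P_meet hq hx (hull_vertex q j) _ (P_inv _ _); rewrite eq_sym ik.
move=> /(_ isT)[_ /(q_inj hq)] jkE; by rewrite jkE eqxx in jk.
Qed.

Lemma interior_P (m : nat) (x : point) : (V q m.+1 `\` V0 q) x ->
  (exists i j, i != j /\ x = qq q i j) \/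
  (exists j y, (V q m `\` V0 q) y /\ x = P q j y).
Proof.
move=> []; rewrite VS => -[j _ [y Vy <-]] nV0.
have [[i _ yE]|nV0y] := pselect (V0 q y); last by right; exists j, y.
left; exists j, i; split; last by rewrite -yE.
by apply/eqP => ji; apply: nV0; rewrite -yE -ji P_fix; exists j.
Qed.

End GraphRecursion.
(** * Harmonic functions *)

Section Harmonic.
Variables (R : realType) (q : 'I_3 -> 'rV[R]_2).
Hypothesis hq : equilateral q.
Local Notation point := 'rV[R]_2.
Local Notation L := (graph_laplacian q).
Local Notation E := (energy q).

Definition defect (u : point -> R) (i j k : 'I_3) : R :=
  u (qq q i j) - (2 / 5 * u (q i) + 2 / 5 * u (q j) + 1 / 5 * u (q k)).

Lemma rule_defect (u : point -> R) : one_fifth_two_fifths_rule q u <->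
  forall i j k, uniq [:: i; j; k] -> defect u i j k = 0.
Proof.
split=> H i j k ijk; first by rewrite /defect (H _ _ _ ijk) subrr.
by apply/eqP; rewrite -subr_eq0; apply/eqP; exact: H.
Qed.

(** Subtracting the harmonic extension of the boundary values, which is
    orthogonal for the energy to functions vanishing on V_0, leaves the
    function with values a, b, c at the three junction points and 0 at the
    corners.  The right-hand side is 5/3 times the sum of its squared
    differences over the nine edges of level 1. *)
Lemma energy_gap (u : point -> R) (i j k : 'I_3) : uniq [:: i; j; k] ->
  let a := defect u j k i in let b := defect u k i j in let c := defect u i j k in
  E 1 u - E 0 u = 5 / 3 * (2 * a ^+ 2 + 2 * b ^+ 2 + 2 * c ^+ 2 +
                           (a - b) ^+ 2 + (b - c) ^+ 2 + (a - c) ^+ 2).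
Proof.
move=> ijk a b c.
rewrite energy_S// (sum_uniq3 _ ijk) !energy_0// !(sum_uniq3 _ ijk) /=.
rewrite !P_fix -!/(qq q _ _) (qqC q j i) (qqC q k j) (qqC q k i).
by rewrite /a /b /c /defect (qqC q k i); field.
Qed.

Lemma energy_0_le (u : point -> R) : E 0 u <= E 1 u.
Proof.
have gap := @energy_gap u i1 i2 i3 isT.
by rewrite -subr_ge0 gap mulr_ge0 ?divr_ge0// !addr_ge0 ?sqr_ge0// mulr_ge0 ?sqr_ge0.
Qed.

Lemma energy_rule (u : point -> R) :
  E 1 u = E 0 u <-> one_fifth_two_fifths_rule q u.
Proof.
rewrite rule_defect; split=> [E10 i j k ijk|u0].
  have := energy_gap u ijk; rewrite E10 subrr => /=.
  set a := defect u j k i; set b := defect u k i j; set c := defect u i j k.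
  move=> gap; apply/eqP; rewrite -sqrf_eq0; apply/eqP.
  have := sqr_ge0 a; have := sqr_ge0 b; have := sqr_ge0 c.
  have := sqr_ge0 (a - b); have := sqr_ge0 (b - c); have := sqr_ge0 (a - c).
  lra.
apply/eqP; rewrite -subr_eq0 (@energy_gap u i1 i2 i3)// !u0//.
by rewrite !subr0 !expr0n/= !mulr0 !addr0 mulr0.
Qed.

Lemma energy_le (m : nat) (u : point -> R) : E m u <= E m.+1 u.
Proof.
elim: m u => [|m IH] u; first exact: energy_0_le.
rewrite energy_S// [leRHS]energy_S// ler_pM2l ?divr_gt0//.
by apply: ler_sum => i _; exact: IH.
Qed.

(** Harmonicity one level at a time: unlike [is_harmonic], the property at
    level m+1 reduces to the property at level m of the three restrictions,
    which permits induction on m. *)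
Definition keeps_energy (m : nat) (u : point -> R) := E m.+1 u = E m u.

(** The three energy differences are nonnegative, so their sum vanishes only if
    each of them does. *)
Lemma keeps_energy_S (m : nat) (u : point -> R) :
  keeps_energy m.+1 u <-> forall i, keeps_energy m (u \o P q i).
Proof.
rewrite /keeps_energy; split=> [Eu i|Eu]; last first.
  by rewrite energy_S// [RHS]energy_S//; congr (_ * _); apply: eq_bigr.
have : 5 / 3 * \sum_i (E m.+1 (u \o P q i) - E m (u \o P q i)) = 0.
  by rewrite sumrB mulrBr -!energy_S// Eu subrr.
move/eqP; rewrite mulf_eq0 (gt_eqF (divr_gt0 _ _))//=.
rewrite psumr_eq0; last by move=> k _; rewrite subr_ge0 energy_le.
move=> /allP/(_ i); rewrite mem_index_enum => /(_ isT)/=.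
by rewrite subr_eq0 => /eqP.
Qed.

Lemma keeps_energy_lin (m : nat) (a : R) (u v : point -> R) :
  keeps_energy m u -> keeps_energy m v ->
  keeps_energy m (fun x => a * u x + v x).
Proof.
elim: m u v => [|m IH] u v.
  rewrite /keeps_energy !energy_rule => ru rv i j k ijk.
  by rewrite (ru _ _ _ ijk) (rv _ _ _ ijk); ring.
move=> /keeps_energy_S ku /keeps_energy_S kv; apply/keeps_energy_S => i.
by apply: (IH (u \o P q i) (v \o P q i)).
Qed.

Lemma keeps_energy_eq (m : nat) (u v : point -> R) :
  (forall n x, V q n x -> u x = v x) -> keeps_energy m u -> keeps_energy m v.
Proof.
move=> uv; rewrite /keeps_energy.
by rewrite (@energy_eq _ q m.+1 u v) ?(@energy_eq _ q m u v)//; exact: uv.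
Qed.

Lemma harmonicP (u : point -> R) :
  is_harmonic q u <-> forall m, keeps_energy m u.
Proof.
split=> H m; first by rewrite /keeps_energy (H m.+1).
by case: m => // m _; exact/esym/H.
Qed.

Lemma harmonic_rule (u : point -> R) :
  is_harmonic q u -> one_fifth_two_fifths_rule q u.
Proof. by move=> /harmonicP/(_ 0)/energy_rule. Qed.

Lemma harmonic_P (i : 'I_3) (u : point -> R) :
  is_harmonic q u -> is_harmonic q (u \o P q i).
Proof.
move=> /harmonicP hu; apply/harmonicP => m.
by have /keeps_energy_S := hu m.+1.
Qed.

(** The rule around q_j multiplies the second difference at q_j by
    2/5 + 1/5 = 3/5, and restricting to the cell of q_j keeps the function
    harmonic. *)
Lemma harmonic_corner (m : nat) (u : point -> R) (j : 'I_3) :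
  is_harmonic q u -> L m u (q j) = (3 / 5) ^+ m * L 0 u (q j).
Proof.
elim: m u => [|m IH] u hu; first by rewrite mul1r.
rewrite graph_laplacian_corner// IH; last exact: harmonic_P.
rewrite exprSr -mulrA; congr (_ * _); rewrite !graph_laplacian_0//.
have [i ji] := ex_other j.
have [k jik] := ex_third ji; have jki := uniq3_swap (uniq3_rot (uniq3_rot jik)).
have ru := harmonic_rule hu.
rewrite !(sum_uniq3 _ jik)/= P_fix -!/(qq q _ _).
by rewrite (ru _ _ _ jik) (ru _ _ _ jki); field.
Qed.

(** At a junction point both adjacent cells contribute with the same factor
    (3/5)^m, so the sum is (3/5)^m times the level-1 Laplacian, which is 0 by
    the rule. *)
Lemma harmonic_interior (m : nat) (u : point -> R) (x : point) :
  is_harmonic q u -> (V q m `\` V0 q) x -> L m u x = 0.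
Proof.
elim: m u x => [|m IH] u x hu; first by rewrite V_0 => -[].
move=> /interior_P[[i [j [ij ->]]]|[j [y [Vy ->]]]]; last first.
  by rewrite graph_laplacian_inner// IH//; exact: harmonic_P.
rewrite graph_laplacian_junction//.
rewrite (harmonic_corner m j (harmonic_P i hu)).
rewrite (harmonic_corner m i (harmonic_P j hu)).
have [k ijk] := ex_third ij; have ru := harmonic_rule hu.
rewrite !graph_laplacian_0// !(sum_uniq3 _ ijk)/= !P_fix -!/(qq q _ _).
rewrite (qqC q j i) (qqC q i k) (ru _ _ _ ijk).
rewrite (ru _ _ _ (uniq3_rot ijk)) (ru _ _ _ (uniq3_rot (uniq3_rot ijk))).
by field.
Qed.

End Harmonic.
(** * Functions with f o P_i = d f + h_i *)

Section FIF.
Variables (R : realType) (q : 'I_3 -> 'rV[R]_2).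
Hypothesis hq : equilateral q.
Local Notation point := 'rV[R]_2.
Local Notation L := (graph_laplacian q).

Lemma junction_Vstar (i j : 'I_3) : i != j -> (Vstar q `\` V0 q) (qq q i j).
Proof.
move=> ij; split.
  exists 1 => //; rewrite VS; exists i => //; exists (q j) => //.
  by rewrite V_0; exists j.
move=> [k _ kE]; have [ki|ki] := eqVneq k i.
  move: kE; rewrite ki -{1}(P_fix q i) => /P_inj/(q_inj hq) ijE.
  by rewrite ijE eqxx in ij.
have := P_meet hq (hull_vertex q k) (hull_vertex q j) ki.
rewrite P_fix => /(_ kE)[/(q_inj hq) kiE _].
by rewrite kiE eqxx in ki.
Qed.

(** q_i is the limit of the iterates of P_i at any point of SG. *)
Lemma vertex_in_SG (SG : set point) (i : 'I_3) : is_SG q SG -> SG (q i).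
Proof.
move=> [[x0 SGx0] cSG SGE].
have SGP x : SG x -> SG (P q i x).
  by move=> SGx; rewrite SGE; exists i => //; exists x.
have clSG : closed SG by apply: compact_closed => //; exact: norm_hausdorff.
pose u n := 2^-1 ^+ n *: (x0 - q i) + q i.
have SGu n : SG (u n).
  elim: n => [|n IH]; first by rewrite /u expr0 scale1r subrK.
  suff -> : u n.+1 = P q i (u n) by exact: SGP.
  by rewrite /u [RHS]/P -addrA [RHS]scalerDr scalerA -exprS -/(P q i (q i)) P_fix.
apply: (@closed_cvg _ _ \oo _ u SG) => //; first exact: nearW.
rewrite (_ : q i = 0 *: (x0 - q i) + q i); last by rewrite scale0r add0r.
apply: cvgD; last exact: cvg_cst.
apply: cvgZl; apply: cvg_expr; rewrite ger0_norm//; lra.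
Qed.

Lemma V_sub_SG (SG : set point) (m : nat) (x : point) :
  is_SG q SG -> V q m x -> SG x.
Proof.
move=> hSG; elim: m x => [|m IH] x.
  by rewrite V_0 => -[i _ <-]; exact: vertex_in_SG.
rewrite VS => -[i _ [y /IH SGy <-]]; case: hSG => _ _ ->.
by exists i => //; exists y.
Qed.

(** The limit l satisfies l = r l, so l = 0, while all terms have absolute value
    at least |K|. *)
Lemma geometric_cvg_eq0 (r K : R) :
  1 < r -> cvg (r ^+ m * K @[m --> \oo]) -> K = 0.
Proof.
move=> r1 /cvg_ex[/= l ul].
have ul1 : r ^+ m.+1 * K @[m --> \oo] --> l.
  by rewrite (cvg_shiftS (fun m => r ^+ m * K)).
have url : r ^+ m.+1 * K @[m --> \oo] --> r * l.
  by under eq_fun do rewrite exprS -mulrA; apply: cvgMr.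
have l0 : l = 0.
  have /eqP : l = r * l by apply: (cvg_unique _ ul1 url).
  rewrite -{1}[l]mul1r -subr_eq0 -mulrBl mulf_eq0 subr_eq0 eq_sym.
  by rewrite (gt_eqF r1) => /eqP.
apply/eqP; rewrite -normr_le0.
have : `|r ^+ m * K| @[m --> \oo] --> `|l| by exact: cvg_norm.
rewrite l0 normr0 => /cvgr_to_ge; apply; apply: nearW => m.
rewrite normrM ler_peMl// normrX exprn_ege1// ger0_norm ?ltW//.
exact: lt_trans r1.
Qed.

Section FunctionalEquation.
Variables (d : R) (f : point -> R) (h : 'I_3 -> point -> R).
Hypothesis harmh : forall i, is_harmonic q (h i).
Hypothesis fe : forall i m x, V q m x -> f (P q i x) = d * f x + h i x.

Lemma graph_laplacian_P (m : nat) (i : 'I_3) (x : point) :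
  L m (f \o P q i) x = d * L m f x + L m (h i) x.
Proof.
rewrite -graph_laplacian_lin; apply: graph_laplacian_eq => y Vy.
exact: fe Vy.
Qed.

Lemma laplacian_corner_rec (m : nat) (j : 'I_3) :
  L m.+1 f (q j) = d * L m f (q j) + (3 / 5) ^+ m * L 0 (h j) (q j).
Proof.
rewrite graph_laplacian_corner// graph_laplacian_P.
by rewrite (harmonic_corner hq m j (harmh j)).
Qed.

Lemma laplacian_junction_rec (m : nat) (i j : 'I_3) : i != j ->
  L m.+1 f (qq q i j) = d * (L m f (q j) + L m f (q i)) +
    (3 / 5) ^+ m * (L 0 (h i) (q j) + L 0 (h j) (q i)).
Proof.
move=> ij; rewrite graph_laplacian_junction// !graph_laplacian_P.
rewrite (harmonic_corner hq m j (harmh i)) (harmonic_corner hq m i (harmh j)).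
ring.
Qed.

Lemma laplacian_inner_rec (m : nat) (j : 'I_3) (y : point) :
  (V q m `\` V0 q) y -> L m.+1 f (P q j y) = d * L m f y.
Proof.
move=> Vy; rewrite graph_laplacian_inner// graph_laplacian_P.
by rewrite (harmonic_interior hq (harmh j) Vy) addr0.
Qed.

(** The values of h_i on V_0 are determined by f, so the corner Laplacians of
    the h_i in the recursions can be expressed by the values of f on V_1. *)
Lemma h_vertex (i j : 'I_3) : h i (q j) = f (qq q i j) - d * f (q j).
Proof.
have Vj : V q 0 (q j) by rewrite V_0; exists j.
by rewrite /qq (fe i Vj); ring.
Qed.

Lemma laplacian_junction_1 (i j k : 'I_3) : uniq [:: i; j; k] ->
  L 1 f (qq q i j) = defect q f j k i + defect q f k i j - 4 * defect q f i j k.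
Proof.
move=> ijk; rewrite graph_laplacian_junction ?(uniq3_neq ijk)//; last first.
  by case: (uniq3_neq ijk).
rewrite !graph_laplacian_0// !(sum_uniq3 _ ijk)/= !P_fix -!/(qq q _ _) /defect.
by rewrite (qqC q j i) (qqC q k i); field.
Qed.

(** In X_{m+2} - d X_{m+1} the homogeneous parts of the corner recursions
    cancel, leaving (3/5)^m (d (b_i + b_j) + (3/5 - d) c_ij).  The bracket
    depends only on the defects, because it vanishes when f on V_1 is the
    harmonic extension of its boundary values. *)
Lemma laplacian_junction_rec2 (m : nat) (i j k : 'I_3) : uniq [:: i; j; k] ->
  L m.+2 f (qq q i j) = d * L m.+1 f (qq q i j) +
    (3 / 5) ^+ m.+1 * (defect q f j k i + defect q f k i j +
                       (10 * d - 4) * defect q f i j k).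
Proof.
move=> ijk; have [ij _ _] := uniq3_neq ijk.
rewrite (laplacian_junction_rec m.+1 ij) !laplacian_corner_rec.
rewrite (laplacian_junction_rec m ij) !exprS.
rewrite !(@graph_laplacian_0 _ _ hq (h _)) !(sum_uniq3 _ ijk) !h_vertex.
rewrite /defect /qq !P_fix -!/(qq q _ _) (qqC q j i) (qqC q k i).
by field.
Qed.

Lemma scaled_laplacian_rec (m : nat) (i j k : 'I_3) : uniq [:: i; j; k] ->
  scaled_laplacian q m.+2 f (qq q i j) =
  5 * d * scaled_laplacian q m.+1 f (qq q i j) +
  3 ^+ m * (45 / 2 * (defect q f j k i + defect q f k i j +
                       (10 * d - 4) * defect q f i j k)).
Proof.
move=> ijk; rewrite /scaled_laplacian (laplacian_junction_rec2 m ijk).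
rewrite expr_div_n !exprS; field.
by rewrite expf_neq0.
Qed.

(** The last conclusion is stated for d = 1/2 only: there the linear relations
    among the defects leave solutions other than 0, and convergence has to be
    used once more. *)
Lemma laplacian_exists_defect (i j k : 'I_3) : uniq [:: i; j; k] ->
  pointwise_laplacian_exists q f (qq q i j) ->
  defect q f j k i + defect q f k i j + (10 * d - 4) * defect q f i j k = 0 /\
  (d = 1 / 2 -> L 1 f (qq q i j) = 0).
Proof.
move=> ijk /cvg_ex[/= l sl]; have rec m := scaled_laplacian_rec m ijk.
set s := fun m => scaled_laplacian q m f (qq q i j).
have sl1 : s m.+1 @[m --> \oo] --> l by rewrite (cvg_shiftS s).
have sl2 : s m.+2 @[m --> \oo] --> l by rewrite (cvg_shiftS (fun m => s m.+1)).
(* s (m + 2) - 5 d s (m + 1) converges and equals 3^m times a constant. *)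
have K0 : defect q f j k i + defect q f k i j + (10 * d - 4) * defect q f i j k = 0.
  suff /eqP : 45 / 2 * (defect q f j k i + defect q f k i j +
      (10 * d - 4) * defect q f i j k) = 0.
    by rewrite mulf_eq0 gt_eqF ?divr_gt0//= => /eqP.
  apply: (@geometric_cvg_eq0 3); first by rewrite ltr1n.
  apply/cvg_ex; exists (l - 5 * d * l).
  rewrite (_ : (fun m => _) = (fun m => s m.+2 - 5 * d * s m.+1)).
    by apply: cvgB => //; apply: cvgMr.
  by apply/funext => m; rewrite /s rec; ring.
split=> // d12; have sE m : s m.+1 = (5 / 2) ^+ m * s 1.
  elim: m => [|m IH]; first by rewrite mul1r.
  by rewrite [LHS]rec -/(s m.+1) IH K0 d12 exprS; field.
have : s 1 = 0.
  apply: (@geometric_cvg_eq0 (5 / 2)); first by lra.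
  by under eq_fun do rewrite -sE; apply/cvg_ex; exists l.
by rewrite /s /scaled_laplacian expr1; lra.
Qed.

(** The rule for f propagates to the smaller cells: f o P_i = d f + h_i has
    the property at level m as soon as f has it. *)
Lemma rule_keeps_energy (m : nat) :
  one_fifth_two_fifths_rule q f -> keeps_energy q m f.
Proof.
move=> ru; elim: m => [|m IH]; first exact/(energy_rule hq).
apply/(keeps_energy_S hq) => i.
apply: (@keeps_energy_eq _ q m (fun x => d * f x + h i x)).
  by move=> n x Vx /=; rewrite (fe i Vx).
by apply: (keeps_energy_lin hq) => //; have /harmonicP := harmh i.
Qed.

Lemma quadratic_defect (i j k : 'I_3) : quadratic_case q d f ->
  uniq [:: i; j; k] -> defect q f i j k = defect q f i1 i2 i3.
Proof.
move=> [_ E1 E2]; have cases l : [\/ l = i1, l = i2 | l = i3].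
  by case: l => [[|[|[|//]]] ?]; [apply: Or31|apply: Or32|apply: Or33]; apply/val_inj.
by case: (cases i) => ->; case: (cases j) => ->; case: (cases k) => -> //= _;
  rewrite /defect ?(qqC q i2 i1) ?(qqC q i3 i1) ?(qqC q i3 i2); lra.
Qed.

(** With d = 1/5 and equal defects the growing term of the recursion at the
    junction points is x + x - 2 x = 0.  Elsewhere the functional equation
    divides the Laplacian by 5 at each step into a cell, exactly as an increase
    of the level does, which is why the value depends on the level alone. *)
Lemma quadratic_laplacian (m : nat) (x : point) : quadratic_case q d f ->
  (V q m.+1 `\` V0 q) x ->
  L m.+1 f x = (1 / 5) ^+ m * (-2 * defect q f i1 i2 i3).
Proof.
move=> quad; have [d15 _ _] := quad.
have junction n i j : i != j ->
    L n.+1 f (qq q i j) = (1 / 5) ^+ n * (-2 * defect q f i1 i2 i3).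
  move=> ij; have [k ijk] := ex_third ij.
  have jki := uniq3_rot ijk; have kij := uniq3_rot jki.
  elim: n => [|n IH].
    rewrite (laplacian_junction_1 ijk) (quadratic_defect quad ijk).
    by rewrite (quadratic_defect quad jki) (quadratic_defect quad kij); ring.
  rewrite (laplacian_junction_rec2 n ijk) IH (quadratic_defect quad ijk).
  rewrite (quadratic_defect quad jki) (quadratic_defect quad kij) d15.
  set c := defect q f i1 i2 i3.
  have -> : c + c + (10 * (1 / 5) - 4) * c = 0 by field.
  by rewrite mulr0 addr0 mulrA -exprS.
elim: m x => [|m IH] x /interior_P[[i [j [ij ->]]]|[j [y [Vy ->]]]].
- exact: junction.
- by move: Vy; rewrite V_0 => -[].
- exact: junction.
- by rewrite laplacian_inner_rec// IH// d15 exprS mulrA.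
Qed.

End FunctionalEquation.
End FIF.

Theorem theorem3p7 (R : realType) (q : 'I_3 -> 'rV[R]_2) (SG : set 'rV[R]_2)
    (d : R) (f : 'rV[R]_2 -> R)
    (hq : equilateral q) (hSG : is_SG q SG) (hf : is_FIF q SG d f)
    (hlap : forall p, (Vstar q `\` V0 q) p -> pointwise_laplacian_exists q f p) :
  [/\ one_fifth_two_fifths_rule q f \/ quadratic_case q d f,
      one_fifth_two_fifths_rule q f ->
        is_harmonic q f /\ has_laplacian q SG f (fun=> 0) &
      quadratic_case q d f ->
        has_laplacian q SG f
          (fun=> 3 * (2 * f (q i1) + 2 * f (q i2) + f (q i3)
                      - 5 * f (qq q i1 i2)))].
Proof.
case: hf => _ fcont [h [harmh fe0]].
have fe i m x : V q m x -> f (P q i x) = d * f x + h i x.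
  by move=> Vx; apply: fe0; exact: V_sub_SG hSG Vx.
have ccont c : {within SG, continuous (fun=> c : R)} by move=> x; exact: cvg_cst.
split=> [|ru|quad].
- have rel i j k (ijk : uniq [:: i; j; k]) :=
    laplacian_exists_defect hq harmh fe ijk
      (hlap _ (junction_Vstar hq (let: And3 ij _ _ := uniq3_neq ijk in ij))).
  have [d15|d15] := eqVneq d (1 / 5).
    right; have [r3 _] := rel i1 i2 i3 isT; have [r1 _] := rel i2 i3 i1 isT.
    have [r2 _] := rel i3 i1 i2 isT.
    by split=> //; move: r1 r2 r3; rewrite d15 /defect (qqC q i3 i1); lra.
  left; apply/rule_defect => i j k ijk.
  have [rk halfk] := rel i j k ijk; have [ri _] := rel j k i (uniq3_rot ijk).
  have [rj _] := rel k i j (uniq3_rot (uniq3_rot ijk)).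
  move: rk ri rj halfk; rewrite (laplacian_junction_1 hq f ijk).
  set a := defect q f j k i; set b := defect q f k i j; set c := defect q f i j k.
  move=> rk ri rj halfk.
  (* the sum of the three relations, then the relation for c alone *)
  have /eqP : (10 * d - 2) * (a + b + c) = 0 by lra.
  have d15' : 10 * d - 2 != 0 by apply: contra_neq d15 => E; lra.
  rewrite mulf_eq0 (negPf d15')/= => /eqP S0.
  have /eqP : (10 * d - 5) * c = 0 by lra.
  rewrite mulf_eq0 => /orP[/eqP d12|/eqP//].
  have := halfk ltac:(lra); lra.
- have hf : is_harmonic q f.
    by apply/harmonicP => m; apply: (rule_keeps_energy hq harmh fe).
  split=> //; split=> // e e0; apply: nearW => m x Vx.
  by rewrite /scaled_laplacian harmonic_interior// mulr0 subr0 normr0 ltW.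
split=> // e e0; exists 1%N => // -[//|m] _ x Vx.
rewrite /scaled_laplacian (quadratic_laplacian hq harmh fe quad Vx).
rewrite (_ : _ - _ = 0) ?normr0 ?ltW//.
rewrite /defect expr_div_n expr1n exprS; field.
by rewrite expf_neq0.
Qed.
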